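(* Let $S$ be an outdegree sequence of some rooted tree. Among all rooted trees with outdegree sequence $S$, the greedy caterpillar $G(S)$ has the maximum ancestral spectral radius $\rho_C$.
   Context: A rooted tree $T$ has a distinguished vertex $r$, the root; the level $\ell(v)$ of a vertex $v$ is its distance from $r$. A leaf is a vertex without children (the root counts as a leaf only if it is the only vertex). For vertices $v,w$, $v\vee w$ denotes the common ancestor of $v$ and $w$ farthest from the root (every vertex is an ancestor of itself). If $v_1,\ldots,v_n$ are the leaves, the ancestral matrix $C(T)$ is the $n\times n$ matrix with $(i,j)$ entry $\ell(v_i\vee v_j)$, and the ancestral spectral radius $\rho_C(T)$ is its largest eigenvalue. The outdegree of a vertex is its number of children; the outdegree sequence of $T$ is the (multi)set of outdegrees of all its vertices. A rooted caterpillar is a rooted tree such that removing all leaves yields a path with the root at one end (the backbone). Given $S$ with non-zero entries $s_1\le s_2\le\cdots\le s_m$, the greedy caterpillar $G(S)$ is the rooted caterpillar whose backbone is $u_1=r,u_2,\ldots,u_m$ (with $u_{i+1}$ a child of $u_i$), where $u_i$ has exactly $s_i$ children: for $i<m$ these are $u_{i+1}$ and $s_i-1$ leaves, and $u_m$ has $s_m$ leaf children. Thus the outdegrees of the internal vertices are non-decreasing along the backbone, and $G(S)$ has outdegree sequence $S$. *)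

(* Defs.v *)
From HB Require Import structures.
From mathcomp Require Import all_boot all_order all_algebra.
From mathcomp Require Import classical_sets reals.

Set Implicit Arguments.
Unset Strict Implicit.
Unset Printing Implicit Defensive.

Import Order.TTheory GRing.Theory Num.Theory.

(* A finite rooted tree, given by its parent map; the root is, by convention,
   its own parent, and every vertex reaches the root by iterating parent. *)
Record rtree := RTree {
  vertex :> finType;
  root : vertex;
  parent : vertex -> vertex;
  parent_root : parent root = root;
  root_reached : forall v, fconnect parent v root }.

Section RootedTree.
Variable T : rtree.
Implicit Types u v w : T.

(* findex counts the applications of parent needed to go from v to the root. *)
Definition level v : nat := findex (@parent T) v (root T).

Definition ancestor u v : bool := fconnect (@parent T) v u.

(* The root is excluded because it is its own parent only by convention. *)
Definition children v : {set T} :=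
  [set u | (u != root T) && (parent u == v)].

Definition outdegree v : nat := #|children v|.

Definition leaves : {set T} := [set v | outdegree v == 0].

(* v \vee w: the root is only the default value of arg max, and is itself a
   common ancestor of v and w. *)
Definition join v w : T :=
  [arg max_(u > root T | ancestor u v && ancestor u w) level u].

Definition outdegrees : seq nat := [seq outdegree v | v : T].

End RootedTree.

(* Outdegree sequences are multisets, hence lists up to permutation. *)
Definition has_outdegree_sequence (T : rtree) (S : seq nat) : Prop :=
  perm_eq (outdegrees T) S.

Definition ancestral_matrix (R : realType) (T : rtree) : 'M[R]_#|leaves T| :=
  \matrix_(i, j) ((level (join (enum_val i) (enum_val j)))%:R)%R.

(* The matrix is real symmetric of positive size, so its set of eigenvalues is
   finite and nonempty and this supremum is its largest element. *)
Definition ancestral_radius (R : realType) (T : rtree) : R :=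
  sup [set a : R | eigenvalue (ancestral_matrix R T) a]%classic.

Section GreedyCaterpillar.
Variable S : seq nat.

Definition nonzero_degrees : seq nat := sort leq [seq k <- S | k != 0].

Local Notation s := nonzero_degrees.
Local Notation m := (size s).

Lemma nonzero_degrees_gt0 (i : 'I_m) : 0 < nth 0 s i.
Proof.
have: nth 0 s i \in s by rewrite mem_nth.
by rewrite mem_sort mem_filter lt0n => /andP[].
Qed.

(* None is the root and Some (Tagged _ k), with k : 'I_(nth 0 s i), is the
   k-th child of the i-th backbone vertex (both counted from 0). *)
Definition greedy_vertex : finType :=
  option {i : 'I_m & 'I_(nth 0 s i)}.

Definition greedy_child (i : 'I_m) (k : 'I_(nth 0 s i)) : greedy_vertex :=
  Some (Tagged (fun i : 'I_m => 'I_(nth 0 s i)) k).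

(* Backbone vertex 0 is the root; backbone vertex i.+1 is child 0 of backbone
   vertex i.  No child of the last backbone vertex lies on the backbone. *)
Definition backbone (i : 'I_m) : greedy_vertex :=
  match i with
  | Ordinal 0 _ => None
  | Ordinal j.+1 lt_j1_m =>
      let j' := Ordinal (ltnW lt_j1_m) in
      greedy_child (Ordinal (nonzero_degrees_gt0 j'))
  end.

Definition greedy_parent (v : greedy_vertex) : greedy_vertex :=
  if v is Some x then backbone (tag x) else None.

Lemma greedy_root_reached (v : greedy_vertex) : fconnect greedy_parent v None.
Proof.
case: v => [[i k]|]; last exact: connect0.
case: i k => n; elim: n => [|n IHn] lt_n_m k.
  by apply: connect1; apply/eqP.
by apply: connect_trans (IHn (ltnW lt_n_m) _); apply: connect1; apply/eqP.
Qed.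

Definition greedy_caterpillar : rtree :=
  @RTree greedy_vertex None greedy_parent erefl greedy_root_reached.

End GreedyCaterpillar.

(* Main.v *)
Require Import Defs.
From HB Require Import structures.
From mathcomp Require Import all_boot all_order all_algebra.
From mathcomp Require Import complex.
From mathcomp Require Import classical_sets reals.

Set Implicit Arguments.
Unset Strict Implicit.
Unset Printing Implicit Defensive.

Import Order.TTheory GRing.Theory Num.Theory.

(* For a vector x indexed by the leaves, let w(u) be the sum of x over the
   leaves below u.  Counting common ancestors gives
     x C x^T + (sum x)^2 = |x|^2 + sum of w(u)^2 over the internal vertices u.
   The number of leaves below v is 1 + the sum of d(u) - 1 over the descendants
   u of v.  List the internal vertices of T as e_0, e_1, ... by increasing
   level: the internal descendants of e_i are among e_i, e_(i+1), ..., so e_i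
   has at most as many leaves below it as the i-th backbone vertex of G(S),
   whose descendants carry the largest outdegrees.  If x >= 0 is transported to
   G(S) with larger entries on deeper leaves, the leaves below a backbone vertex
   carry the largest entries, so the weight of the i-th backbone vertex is at
   least w(e_i).  Hence the quadratic form of G(S) dominates that of T at
   vectors of equal norm, and Rayleigh quotients compare the radii. *)

(** * Rearrangement: matching sorted lists and comparing sums *)

(** Sort [A] by [f] and [J] by [key], then match elements of equal rank. Only strict inequalities of
    keys are used, since ties are broken arbitrarily. This serves three times: for outdegrees, for
    levels, and for vector entries against leaf depths. *)
Lemma comonotone_enumeration d (X : orderType d) (I J : finType) (A : {set I})
    (f : I -> X) (key : J -> nat) :
  #|J| = #|A| ->
  exists sigma : J -> I, [/\ injective sigma, sigma @: finset.setT = A &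
    forall i j, key i < key j -> (f (sigma i) <= f (sigma j))%O].
Proof.
(* For empty [J] the type [I] may be empty too, leaving no default element for [nth]. *)
move=> cardJA; have [j0 _|J0] := pickP (fun _ : J => true); last first.
  have noJ (j : J) : I by have := J0 j.
  exists noJ; split=> [j||j]; try by have := J0 j.
  move/eqP: cardJA; rewrite (@eq_card0 J) => [|j]; last by have := J0 j.
  rewrite eq_sym cards_eq0 => /eqP->; apply/finset.setP => i; rewrite inE.
  by apply/imsetP => -[j]; have := J0 j.
have /card_gt0P[i0 _] : 0 < #|A| by rewrite -cardJA; apply/card_gt0P; exists j0.
pose a := sort (relpre f <=%O) (enum A).
pose b := sort (relpre key leq) (enum J).
have ua : uniq a by rewrite sort_uniq enum_uniq.
have ub : uniq b by rewrite sort_uniq enum_uniq.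
have sa : size a = #|A| by rewrite size_sort -cardE.
have mem_b j : j \in b by rewrite mem_sort mem_enum.
have idx j : index j b < size a.
  by rewrite sa -cardJA cardE -(size_sort (relpre key leq)) index_mem mem_b.
pose sigma j := nth i0 a (index j b).
have sigma_inj : injective sigma.
  by move=> i j /eqP; rewrite nth_uniq // => /eqP /index_inj; apply.
exists sigma; split=> // [|i j].
  apply/eqP; rewrite eqEcard card_imset // cardsT cardJA leqnn andbT.
  apply/fintype.subsetP => _ /imsetP[j _ ->].
  by rewrite -mem_enum -(mem_sort (relpre f <=%O)) mem_nth.
move=> lt_ij; have le_idx : index i b <= index j b.
  rewrite leqNgt; apply: contraL lt_ij => /ltnW le_ji; rewrite -leqNgt.
  apply: (@sorted_leq_index _ (relpre key leq) _ _ b _ j i) => //.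
  - by move=> x y z; apply: leq_trans.
  - by move=> x /=.
  - by apply: sort_sorted => x y; apply: leq_total.
apply: (@sorted_leq_nth _ (relpre f <=%O) _ _ i0 a _ _ _ _ _ le_idx).
- by move=> x y z; apply: le_trans.
- by move=> x /=.
- by apply: sort_sorted => x y; apply: le_total.
- exact: idx.
- exact: idx.
Qed.

(** The common part of [P] and [Q] cancels. What remains of [P] has at most as many elements as what
    remains of [Q], and the maximum [y a] over the former separates the values on the two
    remainders. *)
Lemma ler_sum_exchange (R : realDomainType) (J : finType) (P Q : pred J)
    (y : J -> R) :
  #|P| <= #|Q| -> (forall j, (0 <= y j)%R) ->
  (forall a b, ~~ Q a -> Q b -> (y a <= y b)%R) ->
  (\sum_(j | P j) y j <= \sum_(j | Q j) y j)%R.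
Proof.
move=> le_PQ y_ge0 yPQ.
rewrite (bigID Q) [leRHS](bigID P) /=.
under [X in (_ <= X + _)%R]eq_bigl do rewrite andbC.
rewrite lerD2l.
have le_D : #|[pred j | P j & ~~ Q j]| <= #|[pred j | Q j & ~~ P j]|.
  rewrite -(leq_add2l #|[predI P & Q]|).
  rewrite [X in X <= _](_ : _ = #|P|); last first.
    by rewrite -(cardID Q P); congr (_ + _); apply: eq_card => j;
      rewrite !inE andbC.
  rewrite (leq_trans le_PQ) // -(cardID P Q) leq_add //;
    apply/eq_leq/eq_card => j.
    by rewrite !inE andbC.
  by rewrite !inE andbC.
have [a0 a0D|noD] := pickP [pred j | P j & ~~ Q j]; last first.
  by rewrite big_pred0 // sumr_ge0.
have [a aD max_a] := Order.TotalTheory.arg_maxP y a0D.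
apply: (@le_trans _ _ (y a *+ #|[pred j | Q j & ~~ P j]|)%R).
  apply: (@le_trans _ _ (y a *+ #|[pred j | P j & ~~ Q j]|)%R).
    by rewrite -sumr_const; apply: ler_sum.
  by rewrite ler_wpMn2l.
rewrite -sumr_const; apply: ler_sum => b /andP[Qb _].
by apply: yPQ => //; case/andP: aD.
Qed.

(** * Rayleigh quotients of real symmetric matrices *)

Section Rayleigh.
Local Open Scope ring_scope.
Local Open Scope sesquilinear_scope.

Lemma row_sqrE (R : pzRingType) (n : nat) (v : 'rV[R]_n) :
  (v *m v^T) 0 0 = \sum_i v 0 i ^+ 2.
Proof. by rewrite mxE; apply: eq_bigr => i _; rewrite mxE. Qed.

Lemma row_sqr_gt0 (R : realDomainType) (n : nat) (v : 'rV[R]_n) :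
  v != 0 -> 0 < (v *m v^T) 0 0.
Proof.
move=> /rV0Pn[i vi]; rewrite row_sqrE (bigD1 i) //=.
by rewrite ltr_pwDl ?lt_def ?sqrf_eq0 ?vi ?sqr_ge0 // sumr_ge0 // => j _;
  rewrite sqr_ge0.
Qed.

(** Over [R[i]] the matrix is Hermitian, hence unitarily diagonalizable with real eigenvalues; the
    largest of them is the witness. *)
Lemma rayleigh_max (R : rcfType) (n : nat) (A : 'M[R]_n) :
  (0 < n)%N -> A^T = A ->
  exists2 a, eigenvalue A a &
    forall y : 'rV_n, (y *m A *m y^T) 0 0 <= a * (y *m y^T) 0 0.
Proof.
move=> n_gt0 symA; pose toC := @real_complex R : {rmorphism R -> R[i]}.
pose B := map_mx toC A; pose P := spectralmx B; pose d := spectral_diag B.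
have realB : B \is a mxOver Num.real.
  by apply/mxOverP => i j; rewrite mxE /= complex_real.
have hermB : B \is hermsymmx.
  apply: realsym_hermsym => //; apply/is_hermitianmxP.
  by rewrite expr0 scale1r map_mx_id // map_trmx symA.
have defB : B = invmx P *m diag_mx d *m P.
  exact/orthomx_spectralP/hermitian_normalmx.
have uP : P \is unitarymx by exact: spectral_unitarymx.
have iP : P \in unitmx by exact: spectral_unit.
have dR i : d 0 i = toC (complex.Re (d 0 i)).
  by apply/esym/RRe_real/mxOverP/hermitian_spectral_diag_real.
pose r i := complex.Re (d 0 i).
have i0 : 'I_n := Ordinal n_gt0.
have [i _ max_i] := Order.TotalTheory.arg_maxP r (erefl true : xpredT i0).
exists (r i).
  (* Being an eigenvalue descends from [R[i]] to [R]. Since [P *m B = diag_mx d *m P], the rows of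
     [P] are eigenvectors. *)
  rewrite -(eigenvalue_map toC) -dR -/B; apply/eigenvalueP; exists (row i P).
    rewrite defB -row_mul !mulmxA mulmxV // mul1mx.
    by rewrite row_mul row_diag_mx -scalemxAl -rowE.
  apply/eqP => /(congr1 (mulmx^~ (invmx P))).
  rewrite rowE mulmxK // mul0mx => /matrixP/(_ 0 i).
  by rewrite !mxE !eqxx => /eqP; rewrite oner_eq0.
(* In the coordinates [z] of [y] in the eigenbasis, both forms are weighted sums of the squared
   moduli of the [z 0 j]. *)
move=> y; pose yC := map_mx toC y; pose z := yC *m P^t*.
have defy : yC = z *m P by rewrite -mulmxA -invmx_unitary // mulVmx // mulmx1.
have tyC : yC^t* = map_mx toC (y^T).
  by apply/matrixP => k l; rewrite !mxE conj_Creal // complex_real.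
have norm_y : toC ((y *m y^T) 0 0) = \sum_j `|z 0 j| ^+ 2.
  transitivity ((yC *m yC^t* ) 0 0); first by rewrite tyC -map_mxM [RHS]mxE.
  rewrite defy trmx_mul map_mxM mulmxA mulmxtVK // mxE.
  by apply: eq_bigr => j _; rewrite !mxE normCK.
have quad_y : toC ((y *m A *m y^T) 0 0) = \sum_j d 0 j * `|z 0 j| ^+ 2.
  transitivity ((yC *m B *m yC^t* ) 0 0).
    by rewrite tyC -!map_mxM [RHS]mxE.
  rewrite defB defy trmx_mul map_mxM !mulmxA mulmxtVK // mulmxK //.
  rewrite mxE; apply: eq_bigr => j _; rewrite mul_mx_diag !mxE normCK.
  by rewrite mulrAC mulrC.
rewrite -lecR rmorphM -/(toC _) -/(toC _) quad_y norm_y mulr_sumr.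
apply: ler_sum => j _; apply: ler_wpM2r; first by rewrite exprn_ge0.
by rewrite dR lecR; apply: max_i.
Qed.

End Rayleigh.

(** * Ancestors, levels, and counting of descendants and leaves *)

Section Ancestors.
Variable T : rtree.
Implicit Types u v w : T.

Lemma level_root : level (Defs.root T) = 0.
Proof. exact: findex0. Qed.

Lemma level_parent v : v != Defs.root T -> level v = (level (parent v)).+1.
Proof.
by move=> vr; rewrite /level fconnect_findex ?root_reached // eq_sym.
Qed.

Lemma rtree_ind (P : T -> Prop) :
  P (Defs.root T) -> (forall v, v != Defs.root T -> P (parent v) -> P v) ->
  forall v, P v.
Proof.
move=> Pr Pp v; have [n] := ubnP (level v).
elim: n v => // n IHn v; rewrite ltnS => le_vn.
have [-> //|vr] := eqVneq v (Defs.root T).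
by apply: Pp => //; apply: IHn; rewrite -(level_parent vr).
Qed.

Lemma ancestor_refl v : ancestor v v.
Proof. exact: connect0. Qed.

Lemma ancestor_trans v u w : ancestor u v -> ancestor v w -> ancestor u w.
Proof. by move=> uv vw; apply: connect_trans vw uv. Qed.

Lemma ancestorE u v : ancestor u v = (v == u) || ancestor u (parent v).
Proof. exact: fconnect_eqVf. Qed.

Lemma ancestor_root_eq u : ancestor u (Defs.root T) = (u == Defs.root T).
Proof.
apply/idP/eqP => [/iter_findex <-|->]; last exact: ancestor_refl.
by elim: (findex _ _ _) => //= n ->; rewrite parent_root.
Qed.

Lemma leq_level u v : ancestor u v -> level u <= level v ?= iff (u == v).
Proof.
elim/rtree_ind: v => [|v vr IHv].
  by rewrite ancestor_root_eq => /eqP->; apply/leqif_refl; rewrite eqxx.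
rewrite ancestorE => /predU1P[->|/IHv[le_uv _]].
  by apply/leqif_refl; rewrite eqxx.
have lt_uv : level u < level v by rewrite (level_parent vr) ltnS.
split; first exact: ltnW.
by rewrite ltn_eqF //; apply/esym/eqP => uv; rewrite uv ltnn in lt_uv.
Qed.

(** Move [v] up towards the root: it cannot meet [u] strictly before [w], as [u] would then be
    deeper than [w]. *)
Lemma ancestor_chain u v w :
  ancestor u v -> ancestor w v -> level u <= level w -> ancestor u w.
Proof.
elim/rtree_ind: v => [|v vr IHv].
  by rewrite !ancestor_root_eq => /eqP-> /eqP->; rewrite ancestor_refl.
rewrite (ancestorE w) => uv /predU1P[<- //|wv].
have [<-|neq_vu] := eqVneq v u.
  by rewrite leqNgt (level_parent vr) ltnS (leq_level wv).
by move: uv; rewrite ancestorE (negPf neq_vu) => /IHv; apply.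
Qed.

(** Levels become counts of vertices, so that matrix entries can be expanded as sums over common
    ancestors. *)
Lemma card_ancestors v : #|[set u | ancestor u v]| = (level v).+1.
Proof.
elim/rtree_ind: v => [|v vr IHv].
  rewrite level_root -(cards1 (Defs.root T)); apply: eq_card => u.
  by rewrite !inE ancestor_root_eq.
have -> : [set u | ancestor u v] = v |: [set u | ancestor u (parent v)].
  by apply/setP => u; rewrite !inE ancestorE eq_sym.
rewrite cardsU1 IHv inE -level_parent //.
case: (boolP (ancestor v _)) => [/leq_level[]|//].
by rewrite (level_parent vr) ltnn.
Qed.

Lemma ancestor_join u v w :
  ancestor u (join v w) = ancestor u v && ancestor u w.
Proof.
rewrite /join; case: arg_maxnP => [|x /andP[xv xw] max_x].
  by rewrite /ancestor !root_reached.
apply/idP/andP => [ux|[uv uw]]; first by split; apply: ancestor_trans ux _.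
by apply: (ancestor_chain uv xv); apply: max_x; rewrite uv.
Qed.

Lemma card_common_ancestors v w :
  #|[set u | ancestor u v && ancestor u w]| = (level (join v w)).+1.
Proof.
by rewrite -card_ancestors; apply: eq_card => u; rewrite !inE ancestor_join.
Qed.

(** Double counting: each proper descendant of [v] is a child of exactly one descendant of [v],
    namely its parent; the successor accounts for [v] itself. *)
Lemma card_descendants v :
  #|[set u | ancestor v u]| = (\sum_(u | ancestor v u) outdegree u).+1.
Proof.
rewrite (cardsD1 v) inE ancestor_refl add1n; congr _.+1.
under eq_bigr do rewrite /outdegree -sum1_card.
rewrite (exchange_big_dep (fun w => w \in [set u | ancestor v u] :\ v)) /=.
  rewrite -sum1_card; apply: eq_bigr => w; rewrite !inE => /andP[wv vw].
  have vpw : ancestor v (parent w) by move: vw; rewrite ancestorE (negPf wv).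
  have wr : w != Defs.root T.
    by apply: contraNneq wv => wr; move: vw; rewrite wr ancestor_root_eq eq_sym.
  rewrite (big_pred1 (parent w)) // => u; rewrite inE wr /=.
  by rewrite (eq_sym u); case: eqP => [<-|]; rewrite ?vpw ?andbF.
move=> u w vu; rewrite !inE => /andP[wr /eqP def_u].
have vw : ancestor v w by rewrite ancestorE def_u vu orbT.
rewrite vw andbT; apply: contraTneq (vu) => wv.
apply/negP => /leq_level[]; rewrite -def_u -wv (level_parent wr).
by rewrite ltnn.
Qed.

Definition leaves_below v : {set T} := [set l in leaves T | ancestor v l].

Lemma card_leaves_below v :
  #|leaves_below v| = (\sum_(u | ancestor v u) (outdegree u).-1).+1.
Proof.
(* Adding the number of internal descendants gives all descendants on the left and restores the full
   outdegrees on the right. A leaf contributes nothing to either sum, because [0.-1] is [0]. *)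
apply: (@addnI (\sum_(u | ancestor v u) (outdegree u != 0))); rewrite addnS.
rewrite -big_split /=.
rewrite [in RHS](eq_bigr (@outdegree T)) => [|u _]; last by case: outdegree.
rewrite -card_descendants -!sum1_card big_mkcond.
under [X in _ + X = _]eq_bigl do rewrite !inE andbC.
under [RHS]eq_bigl do rewrite inE.
rewrite -big_mkcond [X in _ + X]big_mkcondr -big_split /=.
by apply: eq_bigr => u _; case: eqP.
Qed.

Lemma card_rtree : #|T| = (sumn (outdegrees T)).+1.
Proof.
rewrite sumnE big_map big_enum /=.
rewrite (eq_bigl (ancestor (Defs.root T))) => [|u]; last first.
  exact/esym/root_reached.
rewrite -card_descendants; apply: eq_card => u.
by rewrite !inE; apply/esym/root_reached.
Qed.

Lemma card_leaves_gt0 : 0 < #|leaves T|.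
Proof.
have /card_gt0P[l] : 0 < #|leaves_below (Defs.root T)|.
  by rewrite card_leaves_below.
by rewrite inE => /andP[leaf_l _]; apply/card_gt0P; exists l.
Qed.

End Ancestors.

(** * The quadratic form of the ancestral matrix *)

Section Quadratic.
Variables (R : realType) (T : rtree).
Implicit Types x : 'rV[R]_#|leaves T|.

Definition weight x (u : T) : R :=
  (\sum_(i | ancestor u (enum_val i)) x 0 i)%R.

Definition internal : {set T} := ~: leaves T.

Lemma in_internal u : (u \in internal) = (outdegree u != 0).
Proof. by rewrite !inE. Qed.

Lemma ancestor_leaf (u l : T) : l \in leaves T -> ancestor l u = (u == l).
Proof.
rewrite inE cards_eq0 => /eqP ch0.
elim/rtree_ind: u => [|u ur IHu]; first by rewrite ancestor_root_eq eq_sym.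
rewrite ancestorE IHu; case: eqP => //= _.
by apply/eqP => pu; move/finset.setP/(_ u): ch0; rewrite !inE ur pu eqxx.
Qed.

(** The squared sum raises each coefficient from the level of the join to that level plus one, the
    number of common ancestors. Summing over the ancestor first then yields squared weights. *)
Lemma ancestral_form x :
  ((x *m ancestral_matrix R T *m x^T) 0 0 + (\sum_i x 0 i) ^+ 2 =
   \sum_i x 0 i ^+ 2 + \sum_(u in internal) weight x u ^+ 2)%R.
Proof.
(* A leaf has only itself below it, so its weight is its own entry and the leaves account for the
   squared norm. *)
transitivity (\sum_(u : T) weight x u ^+ 2)%R; last first.
  rewrite (bigID (mem (leaves T))) /=; congr (_ + _)%R; last first.
    by apply: eq_bigl => u; rewrite !inE.
  rewrite big_enum_val /=; apply: eq_bigr => i _; congr (_ ^+ 2)%R.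
  rewrite /weight (big_pred1 i) // => j.
  by rewrite ancestor_leaf ?enum_valP // (inj_eq enum_val_inj).
transitivity (\sum_i \sum_j \sum_(u in [set u | ancestor u (enum_val i) &&
    ancestor u (enum_val j)]%SET) x 0 i * x 0 j)%R.
  rewrite mxE expr2 big_distrl /= exchange_big -big_split /=.
  apply: eq_bigr => j _.
  rewrite !mxE big_distrl big_distrr -big_split /=; apply: eq_bigr => i _.
  rewrite mxE sumr_const card_common_ancestors.
  by rewrite mulrS mulr_natr mulrnAl addrC [(x 0 j * _)%R]mulrC.
under eq_bigr do (under eq_bigr do rewrite big_mkcond /=; rewrite exchange_big).
rewrite exchange_big; apply: eq_bigr => u _.
rewrite /weight expr2 big_distrl /= [RHS]big_mkcond /=; apply: eq_bigr => i _.
under eq_bigr do rewrite inE.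
case: ifP => ui /=; last exact: big1.
by rewrite big_distrr [RHS]big_mkcond.
Qed.

Lemma ancestral_matrix_sym :
  ((ancestral_matrix R T)^T = ancestral_matrix R T)%R.
Proof.
apply/matrixP => i j; rewrite !mxE; congr (_%:R)%R; apply: succn_inj.
rewrite -!card_ancestors; apply: eq_card => u.
by rewrite !inE !ancestor_join andbC.
Qed.

(** The supremum is attained: the eigenvalue given by [rayleigh_max] bounds every other one, as seen
    by evaluating the form at an eigenvector. *)
Lemma ancestral_radiusP :
  eigenvalue (ancestral_matrix R T) (ancestral_radius R T) /\
  (forall x, (x *m ancestral_matrix R T *m x^T) 0 0 <=
             ancestral_radius R T * (x *m x^T) 0 0)%R.
Proof.
have [a eig_a max_a] :=
  rayleigh_max (card_leaves_gt0 T) ancestral_matrix_sym.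
suff -> : ancestral_radius R T = a by [].
have ub_a : ubound [set b : R | eigenvalue (ancestral_matrix R T) b]%classic a.
  move=> b /= /eigenvalueP[v vA v_neq0].
  by have := max_a v; rewrite vA -scalemxAl mxE ler_pM2r // row_sqr_gt0.
apply/eqP; rewrite eq_le ub_le_sup // ?andbT; last by exists a.
by apply: ge_sup => //; exists a.
Qed.

End Quadratic.

(** * Structure of the greedy caterpillar *)

Section Greedy.
Variable S : seq nat.
Local Notation G := (greedy_caterpillar S).
Local Notation s := (nonzero_degrees S).
Local Notation m := (size s).
Local Notation bb := (@backbone S : 'I_m -> G).

(** The level in [G], read directly off the encoding of the vertices. *)
Definition depth (v : G) : nat := if v is Some x then (tag x).+1 else 0.

Lemma depth_backbone i : depth (bb i) = i.
Proof. by case: i => -[|j] ltjm. Qed.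

Lemma backbone_inj : injective bb.
Proof.
by move=> i j eq_bb; apply: val_inj; rewrite /= -!depth_backbone eq_bb.
Qed.

Lemma outdegree_backbone i : outdegree (bb i) = nth 0 s i.
Proof.
have child_inj : injective (@greedy_child S i).
  by move=> k l [] /eqP; rewrite eq_Tagged /= => /eqP.
rewrite -[RHS]card_ord -cardsT -(card_imset _ child_inj).
apply: eq_card => v; rewrite inE.
apply/andP/imsetP => [[]|[k _ ->]]; last by split; apply/eqP.
case: v => [[j k] _ /eqP /backbone_inj /= eq_ji|/eqP //].
by subst j; exists k.
Qed.

Lemma imset_backbone : bb @: finset.setT = internal G.
Proof.
apply/esym/finset.setP => v; rewrite in_internal.
apply/idP/imsetP => [|[i _ ->]].
  rewrite -lt0n => /card_gt0P[[[i k]|]]; rewrite inE; last by case/andP => /eqP.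
  by case/andP=> _ /eqP <-; exists i; rewrite ?finset.in_setT.
by rewrite outdegree_backbone -lt0n nonzero_degrees_gt0.
Qed.

Lemma ancestor_backbone (i j : 'I_m) : i <= j -> ancestor (bb i) (bb j).
Proof.
case: i j => i lt_im [j lt_jm]; rewrite [X in X -> _]/=.
elim: j lt_jm => [|j IHj] lt_jm.
  rewrite leqn0 => /eqP i0.
  rewrite (_ : Ordinal lt_im = Ordinal lt_jm) ?ancestor_refl //.
  exact: val_inj.
rewrite leq_eqVlt => /predU1P[eq_ij|lt_ij].
  rewrite (_ : Ordinal lt_im = Ordinal lt_jm) ?ancestor_refl //.
  exact: val_inj.
rewrite ancestorE; apply/orP; right.
exact: IHj (ltnW lt_jm) lt_ij.
Qed.

Lemma leq_depth (u v : G) : ancestor u v -> depth u <= depth v.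
Proof.
elim/rtree_ind: v => [|[[j k] _ IHv|//]].
  by rewrite ancestor_root_eq => /eqP->.
rewrite ancestorE => /predU1P[<- //|/IHv le_d].
by apply: leq_trans le_d _; rewrite depth_backbone.
Qed.

(** A leaf of positive depth [d] hangs from backbone vertex [d.-1], whose ancestors are the backbone
    vertices up to it. Hence the leaves below a backbone vertex are exactly the deep enough ones. *)
Lemma ancestor_backbone_leaf (i : 'I_m) (v : G) :
  v \in leaves G -> ancestor (bb i) v = (i < depth v).
Proof.
move=> leaf_v; apply/idP/idP => [iv|].
  have neq_vi : v != bb i.
    apply: contraTneq leaf_v => ->.
    by rewrite inE outdegree_backbone -lt0n nonzero_degrees_gt0.
  case: v iv neq_vi {leaf_v} => [[j k]|].
    rewrite ancestorE => /orP[->//|/leq_depth].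
    by rewrite /= !depth_backbone.
  by rewrite (ancestor_root_eq (T := G)) eq_sym => ->.
case: v {leaf_v} => [[j k]|//]; rewrite [depth _]/= ltnS => le_ij.
by rewrite ancestorE (ancestor_backbone le_ij) orbT.
Qed.

Lemma card_greedy : #|G| = (sumn S).+1.
Proof.
rewrite card_option card_tagged sumnE big_map big_enum /=; congr _.+1.
under eq_bigr do rewrite card_ord.
rewrite -(big_mkord xpredT (nth 0 s)) -(big_nth 0 xpredT id).
rewrite (perm_big [seq k <- S | k != 0]) ?perm_sort //= big_filter sumnE.
by rewrite big_mkcond /=; apply: eq_bigr => k _; case: eqP.
Qed.

Lemma enum_backbone : perm_eq [seq u : G <- enum G | outdegree u != 0]
  [seq bb i | i <- enum 'I_m].
Proof.
apply: uniq_perm; first by rewrite filter_uniq ?enum_uniq.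
  by rewrite (map_inj_uniq backbone_inj) enum_uniq.
move=> v; rewrite mem_filter mem_enum andbT -in_internal -imset_backbone.
by apply/imsetP/mapP => -[i _ ->]; exists i; rewrite ?mem_enum ?finset.in_setT.
Qed.

Lemma perm_nonzero_zeros (t1 t2 : seq nat) :
  perm_eq [seq k <- t1 | k != 0] [seq k <- t2 | k != 0] -> size t1 = size t2 ->
  perm_eq t1 t2.
Proof.
move=> p12 sz12.
rewrite -(perm_filterC (fun k => k != 0) t1) perm_sym.
rewrite -(perm_filterC (fun k => k != 0) t2) perm_sym.
have zeros t : [seq k <- t | predC (fun k => k != 0) k] =
    nseq (size t - size [seq k <- t | k != 0]) 0.
  rewrite size_filter -(count_predC (fun k => k != 0) t) addKn -size_filter.
  by apply/all_pred1P/allP => k; rewrite mem_filter /= negbK => /andP[].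
by rewrite !zeros sz12 (perm_size p12) perm_cat2r.
Qed.

(** The nonzero outdegrees agree by construction. The zeros then agree because both trees have one
    vertex more than the sum of [S], and [T] has as many vertices as [S] has entries. *)
Lemma greedy_outdegrees (T : rtree) :
  has_outdegree_sequence T S -> has_outdegree_sequence G S.
Proof.
move=> TS; apply: perm_nonzero_zeros; last first.
  rewrite size_image card_greedy -(perm_size TS) size_image.
  by rewrite card_rtree (perm_sumn TS).
rewrite filter_map (perm_trans (perm_map _ enum_backbone)) // -map_comp.
rewrite (eq_map outdegree_backbone) map_comp val_enum_ord map_nth_iota0 //.
by rewrite take_size perm_sort.
Qed.

End Greedy.

(** * Sums and counts along enumerations *)

Lemma big_enumeration (X : Type) (idx : X) (op : Monoid.com_law idx)
    (I J : finType) (A : {set I}) (sigma : J -> I) (P : pred I) (F : I -> X) :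
  injective sigma -> sigma @: finset.setT = A ->
  \big[op/idx]_(i in A | P i) F i = \big[op/idx]_(j | P (sigma j)) F (sigma j).
Proof.
move=> sigma_inj <-; rewrite big_mkcondr /= big_imset /=; last exact: in2W.
by rewrite [RHS]big_mkcond; apply: eq_bigl => j; rewrite finset.in_setT.
Qed.

Lemma card_leaves (T : rtree) : #|leaves T| = count_mem 0 (outdegrees T).
Proof.
rewrite cardE -size_filter filter_map size_map enumT; congr size.
by apply: eq_filter => u; rewrite !inE eq_sym.
Qed.

Lemma card_leaf_indices (T : rtree) (v : T) :
  #|[pred i : 'I_#|leaves T| | ancestor v (enum_val i)]| = #|leaves_below v|.
Proof.
rewrite -[LHS]sum1_card -[RHS]sum1_card; under [RHS]eq_bigl do rewrite inE.
by rewrite [LHS]big_mkcond [RHS]big_mkcondr [RHS]big_enum_val.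
Qed.

Lemma sum_outdegree_below (T : rtree) (J : finType) (sigma : J -> T) (v : T) :
  injective sigma -> sigma @: finset.setT = internal T ->
  \sum_(u | ancestor v u) (outdegree u).-1 =
  \sum_(j | ancestor v (sigma j)) (outdegree (sigma j)).-1.
Proof.
move=> sigma_inj sigma_im.
rewrite -(big_enumeration _ (ancestor v) (fun u => (outdegree u).-1)
  sigma_inj sigma_im).
rewrite [LHS]big_mkcond [RHS]big_mkcond; apply: eq_bigr => u _.
by rewrite in_internal; case: eqP => [->|//]; case: ifP.
Qed.

(** * Comparison of a tree with the greedy caterpillar *)

Section Comparison.
Variables (R : realType) (S : seq nat) (T : rtree).
Hypothesis TS : has_outdegree_sequence T S.
Local Notation G := (greedy_caterpillar S).
Local Notation s := (nonzero_degrees S).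
Local Notation m := (size s).
Local Notation bb := (@backbone S : 'I_m -> G).

Lemma perm_internal_outdegrees :
  perm_eq [seq outdegree u | u <- enum (internal T)] s.
Proof.
rewrite (perm_trans (y := [seq k <- outdegrees T | k != 0])) //.
  rewrite /outdegrees filter_map; apply/perm_map/uniq_perm;
    rewrite ?enum_uniq //.
    by rewrite filter_uniq ?enum_uniq.
  by move=> u; rewrite [LHS]mem_enum [RHS]mem_filter [X in _ && X]mem_enum
    in_internal andbT.
by rewrite perm_sym perm_sort perm_sym perm_filter.
Qed.

Lemma card_internal : #|internal T| = m.
Proof. by rewrite -(perm_size perm_internal_outdegrees) size_map -cardE. Qed.

Lemma internal_by_outdegree : exists tau : 'I_m -> T,
  [/\ injective tau, tau @: finset.setT = internal T &
      forall j, outdegree (tau j) = nth 0 s j].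
Proof.
have cardIm : #|'I_m| = #|internal T| by rewrite card_ord card_internal.
have [tau [tau_inj tau_im tau_mono]] :=
  comonotone_enumeration (@outdegree T) (@nat_of_ord m) cardIm.
exists tau; split=> // j.
suff def_s : [seq outdegree (tau j) | j <- enum 'I_m] = s.
  transitivity (nth 0 [seq outdegree (tau k) | k <- enum 'I_m] j).
    by rewrite (nth_map j) ?size_enum_ord // nth_ord_enum.
  by rewrite def_s.
(* Two sorted lists that are permutations of each other coincide. *)
apply: (sorted_eq leq_trans anti_leq).
- rewrite sorted_map.
  apply: (@sub_sorted _ (relpre (@nat_of_ord m) ltn)) => [i k|].
    exact: tau_mono.
  by rewrite -sorted_map val_enum_ord iota_ltn_sorted.
- exact/sort_sorted/leq_total.
apply: perm_trans perm_internal_outdegrees.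
rewrite (map_comp (@outdegree T) tau); apply/perm_map/uniq_perm.
- by rewrite (map_inj_uniq tau_inj) enum_uniq.
- exact: enum_uniq.
move=> u; rewrite mem_enum -tau_im.
by apply/mapP/imsetP => -[k _ ->]; exists k; rewrite ?mem_enum ?finset.in_setT.
Qed.

Lemma leq_card_leaves_below : exists e : 'I_m -> T,
  [/\ injective e, e @: finset.setT = internal T &
      forall i, #|leaves_below (e i)| <= #|leaves_below (bb i)|].
Proof.
have cardIm : #|'I_m| = #|internal T| by rewrite card_ord card_internal.
have [e [e_inj e_im e_mono]] :=
  comonotone_enumeration (@level T) (@nat_of_ord m) cardIm.
exists e; split=> // i.
(* The enumeration [e] by level bounds how many internal vertices lie below [e i]; [tau], by
   outdegree, makes the summands non-decreasing in the index. *)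
have [tau [tau_inj tau_im tauE]] := internal_by_outdegree.
rewrite !card_leaves_below ltnS (sum_outdegree_below _ tau_inj tau_im).
rewrite (sum_outdegree_below _ (@backbone_inj S) (imset_backbone S)).
under eq_bigr do rewrite tauE.
under [leqRHS]eq_bigr do rewrite outdegree_backbone.
(* The intermediate sum runs over the [m - i] largest outdegrees, all carried by descendants of
   [bb i]. *)
apply: (@leq_trans (\sum_(j : 'I_m | i <= j) (nth 0 s j).-1)); last first.
  rewrite big_mkcond [leqRHS]big_mkcond; apply: leq_sum => j _.
  by case: ifP => // /ancestor_backbone ->.
rewrite -(ler_nat int) !natr_sum.
apply: ler_sum_exchange => [|j|j k]; last 2 first.
- exact: ler0n.
- rewrite -ltnNge => lt_ji le_ik; rewrite ler_nat -!subn1 leq_sub2r //.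
  apply: (sorted_leq_nth leq_trans leqnn); rewrite ?inE //.
    exact/sort_sorted/leq_total.
  exact: ltnW (leq_trans lt_ji le_ik).
(* It remains to bound the number of internal descendants of [e i]. Counted along [e] instead of
   [tau], they have indices at least [i]. *)
rewrite -!sum1_card.
rewrite -(big_enumeration _ (ancestor (e i)) (fun=> 1) tau_inj tau_im).
rewrite (big_enumeration _ (ancestor (e i)) (fun=> 1) e_inj e_im).
rewrite big_mkcond [leqRHS]big_mkcond; apply: leq_sum => j _.
case: ifP => // anc_ij; rewrite -[j \in _]/(i <= j).
case: (leqP i j) => // lt_ji.
(* An index [j < i] would force equal levels, and then the equality case of [leq_level] identifies
   [e i] with [e j]. *)
have [le_ij eq_ij] := leq_level anc_ij.
have := e_mono _ _ lt_ji; rewrite leEnat => le_ji.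
have /eqP/e_inj eq_i : e i == e j by rewrite -eq_ij eqn_leq le_ij.
by rewrite eq_i ltnn in lt_ji.
Qed.

Lemma greedy_weights (x : 'rV[R]_#|leaves T|) :
  (forall i, 0 <= x 0 i)%R -> exists y : 'rV[R]_#|leaves G|,
  [/\ (\sum_i y 0 i = \sum_i x 0 i)%R,
      (\sum_i y 0 i ^+ 2 = \sum_i x 0 i ^+ 2)%R &
      (\sum_(u in internal T) weight x u ^+ 2 <=
       \sum_(u in internal G) weight y u ^+ 2)%R].
Proof.
move=> x_ge0.
have card_eq : #|'I_#|leaves G| | = #|[set: 'I_#|leaves T|]%SET|.
  rewrite cardsT !card_ord !card_leaves.
  by rewrite (permP (greedy_outdegrees TS)) (permP TS).
(* Both trees have as many leaves as [S] has zeros; [sigma] places larger entries of [x] on deeper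
   leaves of [G]. *)
have [sigma [sigma_inj _ sigma_mono]] := comonotone_enumeration
  (fun i => x 0%R i) (fun l => depth (enum_val l)) card_eq.
have sigma_bij : bijective sigma.
  by apply: inj_card_bij sigma_inj _; rewrite card_eq cardsT.
exists (\row_l x 0 (sigma l))%R; split.
- rewrite [RHS](reindex sigma (onW_bij _ sigma_bij)).
  by apply: eq_bigr => l _; rewrite mxE.
- rewrite [RHS](reindex sigma (onW_bij _ sigma_bij)).
  by apply: eq_bigr => l _; rewrite mxE.
have [e [e_inj e_im le_e]] := leq_card_leaves_below.
have reindex_e (F : T -> R) : (\sum_(u in internal T) F u = \sum_i F (e i))%R.
  rewrite -[RHS](big_enumeration _ xpredT F e_inj e_im).
  by apply: eq_bigl => u; rewrite andbT.
have reindex_bb (F : G -> R) : (\sum_(u in internal G) F u = \sum_i F (bb i))%R.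
  rewrite -[RHS](big_enumeration _ xpredT F (@backbone_inj S)
    (imset_backbone S)).
  by apply: eq_bigl => u; rewrite andbT.
rewrite reindex_e reindex_bb; apply: ler_sum => i _.
have w_ge0 : (0 <= weight x (e i))%R by apply: sumr_ge0.
rewrite ler_sqr ?nnegrE //; last by apply: sumr_ge0 => l _; rewrite mxE.
rewrite /weight (reindex sigma (onW_bij _ sigma_bij)).
under [leRHS]eq_bigr do rewrite mxE.
(* At least as many leaves lie below [bb i] as below [e i], and they are the deepest ones, so they
   carry the largest entries. *)
apply: ler_sum_exchange => [|l|k l].
- have := le_e i; rewrite -!card_leaf_indices; apply: leq_trans.
  rewrite -[leqLHS]sum1_card -[leqRHS]sum1_card.
  by rewrite [leqRHS](reindex sigma (onW_bij _ sigma_bij)).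
- exact: x_ge0.
rewrite !ancestor_backbone_leaf ?enum_valP // -leqNgt => le_ki lt_il.
by apply: sigma_mono; apply: leq_ltn_trans le_ki lt_il.
Qed.

Lemma le_ancestral_radius :
  (ancestral_radius R T <= ancestral_radius R G)%R.
Proof.
have [/eigenvalueP[v vA v_neq0] _] := ancestral_radiusP R T.
have [_ max_G] := ancestral_radiusP R G.
(* The matrix has nonnegative entries, so taking absolute values keeps the norm and does not
   decrease the form. This supplies the nonnegative vector that [greedy_weights] requires. *)
pose x : 'rV[R]_#|leaves T| := map_mx Num.norm v.
have [i|y [sum_y sqr_y le_xy]] := @greedy_weights x; first by rewrite mxE.
have sqr_xy : ((v *m v^T) 0 0 = (y *m y^T) 0 0)%R.
  rewrite !row_sqrE sqr_y; apply: eq_bigr => i _.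
  by rewrite mxE real_normK ?num_real.
rewrite -(ler_pM2r (row_sqr_gt0 v_neq0)) [in leRHS]sqr_xy.
apply: le_trans (max_G y).
have -> : (ancestral_radius R T * (v *m v^T) 0 0 =
    (v *m ancestral_matrix R T *m v^T) 0 0)%R by rewrite vA -scalemxAl [RHS]mxE.
apply: (@le_trans _ _ ((x *m ancestral_matrix R T *m x^T) 0 0)%R).
  rewrite !mxE; apply: ler_sum => j _; rewrite !mxE !big_distrl /=.
  apply: ler_sum => i _; rewrite !mxE; apply: le_trans (ler_norm _) _.
  by rewrite !normrM normr_nat.
(* Since [x] and [y] have equal sums, adding the squared sum to both sides reduces the claim to the
   weights. *)
rewrite -(lerD2r ((\sum_i x 0 i) ^+ 2)%R) ancestral_form -sum_y ancestral_form.
by rewrite sqr_y lerD2l.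
Qed.

End Comparison.

Theorem theorem2p9 (R : realType) (S : seq nat)
    (hS : exists T : rtree, has_outdegree_sequence T S) :
  has_outdegree_sequence (greedy_caterpillar S) S /\
  (forall T : rtree, has_outdegree_sequence T S ->
     (ancestral_radius R T <= ancestral_radius R (greedy_caterpillar S))%R).
Proof.
split; first by case: hS => T; apply: greedy_outdegrees.
by move=> T; apply: le_ancestral_radius.
Qed.
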